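(* Suppose $[0,1]_*=([0,1],\min,\max,*,\rightarrowtail,0,1)$ is a BL-algebra. Then every $*$-ball of $[0,1]_*$ is a $*$-open set.
   Context: A BL-algebra is an algebra $\mathcal{L}=(L,\wedge,\vee,*,\rightarrowtail,0,1)$ of type $(2,2,2,2,0,0)$ such that: (BL1) $(L,\wedge,\vee,0,1)$ is a bounded lattice with greatest element $1$ and smallest element $0$; (BL2) $(L,*,1)$ is an Abelian monoid; (BL3) $c\le a\rightarrowtail b$ iff $c*a\le b$ for all $a,b,c\in L$; (BL4) $a\wedge b=a*(a\rightarrowtail b)$ for all $a,b\in L$; (BL5) $(a\rightarrowtail b)\vee(b\rightarrowtail a)=1$ for all $a,b\in L$. Here $L=[0,1]$ is the real unit interval with its usual order. An element $a\in L$ is strongly less than $1$, written $a\ll 1$, if for every $b\in L$, $a\vee b=1$ implies $b=1$ (on $[0,1]$ this just means $a<1$). Define $a\leftrightarrow b=(a\rightarrowtail b)*(b\rightarrowtail a)$ for $a,b\in L$. For $a,r\in L$ with $r\ll 1$, the $*$-ball around $a$ of radius $r$ is $B_r(a)=\{b\in L: a\leftrightarrow b>r\}$. A subset $G\subseteq L$ is $*$-open if for every $a\in G$ there exists $r\in L$ with $r\ll 1$ and $B_r(a)\subseteq G$. *)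

(* Defs.v *)
From HB Require Import structures.
From mathcomp Require Import all_boot all_order all_algebra.
From mathcomp Require Import interval_inference.
From mathcomp Require Import classical_sets reals.

Set Implicit Arguments.
Unset Strict Implicit.
Unset Printing Implicit Defensive.
Import Order.TTheory GRing.Theory Num.Theory.

Local Open Scope order_scope.

(* The bounded lattice reduct (L, meet, join, \bot, \top) is carried by the
   tbLatticeType structure; the order in [BL_res] is the lattice order. *)
Record BL_algebra d (L : tbLatticeType d) (mul imp : L -> L -> L) : Prop := {
  BL_mulA : associative mul;
  BL_mulC : commutative mul;
  BL_mul1 : left_id \top mul;
  BL_res : forall a b c, (c <= imp a b) <-> (mul c a <= b);
  BL_div : forall a b, a `&` b = mul a (imp a b);
  BL_prelin : forall a b, imp a b `|` imp b a = \top
}.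

Definition strongly_lt1 d (L : tbLatticeType d) (a : L) : Prop :=
  forall b : L, a `|` b = \top -> b = \top.

Section StarTopology.
Variables (d : Order.disp_t) (L : tbLatticeType d) (mul imp : L -> L -> L).

Definition biimp (a b : L) : L := mul (imp a b) (imp b a).

(* Only called a ball when the radius [r] satisfies [strongly_lt1 r]. *)
Definition star_ball (r a : L) : set L := [set b | r < biimp a b]%classic.

Definition star_open (G : set L) : Prop :=
  forall a, G a ->
    exists r, strongly_lt1 r /\ (star_ball r a `<=` G)%classic.

End StarTopology.

(* [{i01 R}] is already totally ordered; here it gets its bounds 0 and 1. *)
Section UnitInterval.
Variable R : numDomainType.

Lemma i01_ge0 (x : {i01 R}) : (0%:i01 : {i01 R})%R <= x.
Proof. by rewrite -num_le /= ge0. Qed.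

Lemma i01_le1 (x : {i01 R}) : x <= (1%:i01 : {i01 R})%R.
Proof. by rewrite -num_le /= le1. Qed.

HB.instance Definition _ := Order.hasBottom.Build _ {i01 R} i01_ge0.
HB.instance Definition _ := Order.hasTop.Build _ {i01 R} i01_le1.

Lemma i01_meetE (x y : {i01 R}) : x `&` y = Order.min x y.
Proof. by rewrite meetEtotal. Qed.

Lemma i01_joinE (x y : {i01 R}) : x `|` y = Order.max x y.
Proof. by rewrite joinEtotal. Qed.

Lemma i01_botE : (\bot : {i01 R})%:num%R = 0%R.
Proof. by []. Qed.

Lemma i01_topE : (\top : {i01 R})%:num%R = 1%R.
Proof. by []. Qed.

End UnitInterval.

(* Main.v *)
Require Import Defs.
From mathcomp Require Import all_boot all_order all_algebra.
From mathcomp Require Import interval_inference.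
From mathcomp Require Import classical_sets reals.

(** The biresiduum is transitive, [(a <-> b) * (b <-> c) <= a <-> c].  So if [b]
    lies in the ball of radius [r] around [a] and [t = a <-> b > r], every [c]
    with [b <-> c > t -> r] satisfies [t * (b <-> c) > r] by residuation in a
    chain, hence [a <-> c > r].  The radius [t -> r] is less than [1] because
    [t -> r = 1] would mean [t <= r]. *)

Import Order.TTheory.
Local Open Scope order_scope.

Section Residuation.
Context {d : Order.disp_t} {L : tbLatticeType d} {mul imp : L -> L -> L}.
Hypothesis BL : BL_algebra mul imp.

(** By residuation it suffices that [c <= imp a (mul a c)], the unit of the adjunction. *)
Lemma BL_mul_le2l (a b c : L) : b <= c -> mul a b <= mul a c.
Proof.
move=> le_bc; rewrite (BL_mulC BL a b); apply/(BL_res BL).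
by apply: le_trans le_bc _; apply/(BL_res BL); rewrite (BL_mulC BL).
Qed.

Lemma BL_mul_le2r (a b c : L) : b <= c -> mul b a <= mul c a.
Proof. by rewrite !(BL_mulC BL _ a); apply: BL_mul_le2l. Qed.

Lemma BL_mul_imp_le (a b : L) : mul a (imp a b) <= b.
Proof. by rewrite -(BL_div BL) leIr. Qed.

Lemma BL_imp_trans (a b c : L) : mul (imp a b) (imp b c) <= imp a c.
Proof.
apply/(BL_res BL); rewrite (BL_mulC BL) (BL_mulA BL).
exact: le_trans (BL_mul_le2r _ _ _ (BL_mul_imp_le a b)) (BL_mul_imp_le b c).
Qed.

Lemma BL_biimp_trans (a b c : L) :
  mul (biimp mul imp a b) (biimp mul imp b c) <= biimp mul imp a c.
Proof.
(* Regroup the four factors into the chains from [a] to [c] and from [c] to [a], both passing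
   through [b]. *)
have -> : mul (biimp mul imp a b) (biimp mul imp b c) =
    mul (mul (imp a b) (imp b c)) (mul (imp c b) (imp b a)).
  rewrite /biimp -!(BL_mulA BL); congr mul.
  by rewrite (BL_mulC BL (imp b a)) -!(BL_mulA BL).
apply: le_trans (BL_mul_le2r _ _ _ (BL_imp_trans a b c)) _.
exact: BL_mul_le2l (BL_imp_trans c b a).
Qed.

Lemma BL_imp_top (a b : L) : (imp a b == \top) = (a <= b).
Proof.
by rewrite -le1x; apply/idP/idP => [/(BL_res BL)|le_ab];
  [|apply/(BL_res BL)]; rewrite (BL_mul1 BL).
Qed.

End Residuation.

(** In a chain a join is one of its arguments, so a join equal to [\top] cannot be [a]. *)
Lemma strongly_lt1_lt d (L : tbOrderType d) (a : L) :
  a < \top -> strongly_lt1 a.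
Proof.
move=> lt_a1 b; rewrite joinEtotal; case: leP => // _ a1.
by rewrite a1 ltxx in lt_a1.
Qed.

Lemma star_ball_open d (L : tbOrderType d) (mul imp : L -> L -> L) (r a : L) :
  BL_algebra mul imp -> star_open mul imp (star_ball mul imp r a).
Proof.
move=> BL b; rewrite /star_ball /= => lt_r_ab.
exists (imp (biimp mul imp a b) r); split.
  by apply: strongly_lt1_lt; rewrite lt_neqAle lex1 andbT (BL_imp_top BL) -ltNge.
move=> c /=; rewrite ltNge => /negP nle_bc.
apply: lt_le_trans (BL_biimp_trans BL a b c).
(* Totality turns the strict bound into the negation of [<=], to which residuation applies. *)
rewrite ltNge; apply/negP => le_r; apply: nle_bc.
by apply/(BL_res BL); rewrite (BL_mulC BL).
Qed.

Theorem theorem4p1 (R : realType) (mul imp : {i01 R} -> {i01 R} -> {i01 R}) :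
  BL_algebra mul imp ->
  forall r a : {i01 R}, strongly_lt1 r ->
    star_open mul imp (star_ball mul imp r a).
Proof. by move=> BL r a _; apply: star_ball_open. Qed.
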